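(* Let $X$ and $Y$ be Hausdorff spaces. If $\mathrm{Sh}_{\mathrm{CH}}(X)=\mathrm{Sh}_{\mathrm{CH}}(Y)$ (same compact Hausdorff shape), then $\mathrm{Sh}_{\mathrm{H}}(X)=\mathrm{Sh}_{\mathrm{H}}(Y)$ (same H-shape, i.e. same compactly generated shape).
   Context: Maps are continuous; $[\varphi]$ denotes the homotopy class of a map $\varphi$. HCpt is the category whose objects are compact Hausdorff spaces and whose morphisms are homotopy classes of maps. Direct systems. A directed set is a preordered set in which any two elements have an upper bound. A direct system in a category $\mathscr C$ is $X^*=\{X_a,p_{aa'},A\}$ with $A$ a directed set, objects $X_a$ ($a\in A$), and morphisms $p_{aa'}:X_a\to X_{a'}$ for $a\le a'$, with $p_{aa}=1_{X_a}$ and $X_a\to X_{a'}\to X_{a''}$ composing to $p_{aa''}$ for $a\le a'\le a''$. A morphism $F=(f_a,f):X^*\to Y^*=\{Y_b,q_{bb'},B\}$ consists of an order-preserving function $f:A\to B$ and morphisms $f_a:X_a\to Y_{f(a)}$ with $q_{f(a)f(a')}\circ f_a=f_{a'}\circ p_{aa'}$ for $a\le a'$. Composition is $(g_b,g)\circ(f_a,f)=(g_{f(a)}\circ f_a,\,g\circ f)$, and $1_{X^*}=(1_{X_a},1_A)$. Two morphisms $(f_a,f),(g_a,g):X^*\to Y^*$ are equivalent, written $\simeq$, if for each $a\in A$ there is $b\in B$ with $f(a)\le b$, $g(a)\le b$ and $q_{f(a)b}\circ f_a=q_{g(a)b}\circ g_a$. CH-shape. For a Hausdorff space $X$, let $c(X)$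 be the set of all compact subsets of $X$ ordered by inclusion, and let $C(X)=\{K,[i_{KK'}],c(X)\}$ be the direct system in HCpt where $i_{KK'}:K\to K'$ is the inclusion for $K\subset K'$. $\mathrm{Sh}_{\mathrm{CH}}(X)=\mathrm{Sh}_{\mathrm{CH}}(Y)$ means there are morphisms of direct systems in HCpt $F:C(X)\to C(Y)$ and $G:C(Y)\to C(X)$ with $GF\simeq 1_{C(X)}$ and $FG\simeq 1_{C(Y)}$. H-shape. Let Sh(Cpt) be the (ANR-)shape category of compact Hausdorff spaces: its objects are compact Hausdorff spaces, and a morphism (shape map) $K\to L$ can be described as a natural transformation $[L,-]\to[K,-]$ of set-valued functors on the homotopy category of ANRs (absolute neighborhood retracts for metric spaces), where $[K,P]$ is the set of homotopy classes of maps $K\to P$; composition is composition of natural transformations in the corresponding order. Each homotopy class $[\varphi]:K\to L$ induces a shape map $\overline{\varphi}:K\to L$ by precomposition with $\varphi$. For a Hausdorff space $X$ let $\mathcal C(X)=\{K,\overline{i}_{KK'},c(X)\}$, a direct system in Sh(Cpt). $\mathrm{Sh}_{\mathrm{H}}(X)=\mathrm{Sh}_{\mathrm{H}}(Y)$ means there are morphisms of direct systems in Sh(Cpt) $F':\mathcal C(X)\to\mathcal C(Y)$ and $G':\mathcal C(Y)\to\mathcal C(X)$ with $G'F'\simeq 1_{\mathcal C(X)}$ and $F'G'\simeq 1_{\mathcal C(Y)}$. *)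

(* Defs.v *)
From HB Require Import structures.
From mathcomp Require Import all_boot all_order all_algebra generic_quotient.
From mathcomp Require Import all_classical all_reals topology normedtype.
From mathcomp Require Import lra.

Set Implicit Arguments.
Unset Strict Implicit.
Unset Printing Implicit Defensive.

Import Order.TTheory GRing.Theory Num.Theory.
Import numFieldNormedType.Exports.

Local Open Scope classical_set_scope.
Local Open Scope ring_scope.
Local Open Scope quotient_scope.

Lemma pair_continuous (T U V : topologicalType) (f : T -> U) (g : T -> V) :
  continuous f -> continuous g -> continuous (fun t => (f t, g t)).
Proof. by move=> cf cg t; exact: cvg_pair (cf t) (cg t). Qed.

Lemma fst_continuous (T U : topologicalType) : continuous (@fst T U).
Proof. by move=> t; exact: cvg_fst. Qed.

Lemma snd_continuous (T U : topologicalType) : continuous (@snd T U).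
Proof. by move=> t; exact: cvg_snd. Qed.

Section homotopy.
Context (R : realType).

Definition unit_interval : set R := `[0, 1].

Lemma zero_in_unit : (0 : R) \in unit_interval.
Proof. by apply/mem_set; rewrite /unit_interval /= in_itv /= lexx ler01. Qed.

Lemma one_in_unit : (1 : R) \in unit_interval.
Proof. by apply/mem_set; rewrite /unit_interval /= in_itv /= lexx ler01. Qed.

Definition unit0 : unit_interval := exist _ 0 zero_in_unit.
Definition unit1 : unit_interval := exist _ 1 one_in_unit.

Definition homotopic (X Y : topologicalType) (f g : continuousType X Y) : Prop :=
  exists H : X * unit_interval -> Y,
    [/\ continuous H, forall x, H (x, unit0) = f x & forall x, H (x, unit1) = g x].

(** The retraction of the line onto the unit interval. *)
Definition clamp (t : R) : R := (`|t| - `|t - 1| + 1) / 2.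

Lemma clamp_in t : clamp t \in unit_interval.
Proof.
apply/mem_set; rewrite /unit_interval /clamp /= in_itv /=.
rewrite divr_ge0 ?ler0n//=; last first.
  by rewrite addrAC subr_ge0 -[X in _ <= _ + X]normr1 ler_normB.
rewrite ler_pdivrMr ?ltr0n// mul1r -[2]/(1 + 1) lerD2r lerBlDr.
by rewrite -{1}(subrK 1 t) addrC -[X in _ <= X + _]normr1 ler_normD.
Qed.

Definition to_unit (t : R) : unit_interval := exist _ (clamp t) (clamp_in t).

Lemma to_unit_continuous : continuous to_unit.
Proof.
apply: continuous_comp_initial => t.
apply: (@cvgM _ R); last exact: cvg_cst.
apply: cvgD; last exact: cvg_cst.
apply: cvgB; first by apply: cvg_norm; exact: cvg_id.
by apply: cvg_norm; apply: cvgB; [exact: cvg_id | exact: cvg_cst].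
Qed.

Lemma to_unit_val (t : unit_interval) : to_unit (\val t) = t.
Proof.
apply: val_inj; rewrite /= /clamp.
have := set_mem (valP t); rewrite /unit_interval /= in_itv /= => /andP[t0 t1].
by rewrite ger0_norm// ler0_norm ?subr_le0//; lra.
Qed.

Lemma homotopicP (X Y : topologicalType) (f g : continuousType X Y) :
  homotopic f g <-> exists H : X * R -> Y,
    [/\ continuous H, forall x, H (x, 0) = f x & forall x, H (x, 1) = g x].
Proof.
split=> -[H [cH H0 H1]].
  exists (fun z => H (z.1, to_unit z.2)); split.
  - move=> z; apply: continuous_comp; last exact: cH.
    apply: pair_continuous z; first exact: fst_continuous.
    move=> z; apply: continuous_comp; first exact: snd_continuous.
    exact: to_unit_continuous.
  - by move=> x /=; rewrite (to_unit_val unit0).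
  - by move=> x /=; rewrite (to_unit_val unit1).
exists (fun z : X * unit_interval => H (z.1, \val z.2)); split => //.
move=> z; apply: (@continuous_comp _ _ _
    (fun z : X * unit_interval => (z.1, \val z.2)) H);
  last exact: cH.
move: z; apply: pair_continuous; first exact: fst_continuous.
move=> z; apply: continuous_comp; first exact: snd_continuous.
exact: initial_continuous.
Qed.

Section equivalence.
Context (X Y : topologicalType).

Lemma homotopic_refl (f : continuousType X Y) : homotopic f f.
Proof.
exists (fun z : X * unit_interval => f z.1); split => // z.
apply: (@continuous_comp _ _ _ fst f); first exact: fst_continuous.
exact: cts_fun.
Qed.

Lemma homotopic_reparam (H : X * R -> Y) (a b : R) :
  continuous H -> continuous (fun z : X * R => H (z.1, a * z.2 + b)).
Proof.
move=> cH z.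
apply: (@continuous_comp _ _ _ (fun z => (z.1, a * z.2 + b)) H);
  last exact: cH.
move: z; apply: pair_continuous; first exact: fst_continuous.
move=> z.
apply: (@continuous_comp _ _ _ snd (fun t : R => a * t + b)).
  exact: snd_continuous.
apply: (@cvgD _ R^o); last exact: cvg_cst.
by apply: cvgM; [exact: cvg_cst | exact: cvg_id].
Qed.

Lemma homotopic_sym (f g : continuousType X Y) :
  homotopic f g -> homotopic g f.
Proof.
move=> /homotopicP[H [cH H0 H1]]; apply/homotopicP.
exists (fun z => H (z.1, -1 * z.2 + 1)); split.
- exact: homotopic_reparam.
- by move=> x /=; rewrite mulr0 add0r.
- by move=> x /=; rewrite mulr1 addNr.
Qed.

Lemma homotopic_trans (f g h : continuousType X Y) :
  homotopic f g -> homotopic g h -> homotopic f h.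
Proof.
move=> /homotopicP[F [cF F0 F1]] /homotopicP[G [cG G0 G1]]; apply/homotopicP.
pose F' (z : X * R) := F (z.1, 2 * z.2 + 0).
pose G' (z : X * R) := G (z.1, 2 * z.2 - 1).
pose K (z : X * R) := if z.2 <= 2^-1 then F' z else G' z.
have cF' : continuous F' by exact: homotopic_reparam.
have cG' : continuous G' by exact: homotopic_reparam.
exists K; split.
- pose A := [set z : X * R | z.2 <= 2^-1].
  pose B := [set z : X * R | 2^-1 <= z.2].
  have clA : closed A.
    by apply: (preimage_closed _ (@closed_le R 2^-1)) => z _; exact: snd_continuous.
  have clB : closed B.
    by apply: (preimage_closed _ (@closed_ge R 2^-1)) => z _; exact: snd_continuous.
  have AB : A `|` B = setT.
    apply/seteqP; split=> // z _.
    by case: (leP z.2 2^-1) => [|/ltW]; [left | right].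
  apply/continuous_subspace_setT; rewrite -AB; apply: withinU_continuous => //.
  + apply: (@subspace_eq_continuous _ _ _ F').
      by move=> z /set_mem /= zA; rewrite /from_subspace /K ifT.
    exact: continuous_subspaceT.
  + apply: (@subspace_eq_continuous _ _ _ G').
      move=> z /set_mem /= zB; rewrite /from_subspace /K; case: ifPn => // zA.
      have -> : z = (z.1, 2^-1).
        by rewrite [LHS]surjective_pairing; congr pair; apply/le_anti/andP.
      by rewrite /F' /G' /= divff ?pnatr_eq0// addr0 subrr F1 G0.
    exact: continuous_subspaceT.
- by move=> x; rewrite /K /= invr_ge0 ler0n /F' /= mulr0 addr0.
- move=> x; rewrite /K /= leNgt invf_lt1 ?ltr0n// ltr1n /= /G' /=.
  by rewrite mulr1 -[2]/(1 + 1) addrK.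
Qed.

Definition homotopicb (f g : continuousType X Y) : bool := `[< homotopic f g >].

Lemma homotopicb_refl : reflexive homotopicb.
Proof. by move=> f; apply/asboolP; exact: homotopic_refl. Qed.

Lemma homotopicb_sym : symmetric homotopicb.
Proof. by move=> f g; apply/asboolP/asboolP; exact: homotopic_sym. Qed.

Lemma homotopicb_trans : transitive homotopicb.
Proof.
move=> f g h /asboolP gf /asboolP fh; apply/asboolP.
exact: homotopic_trans fh.
Qed.

Canonical homotopic_equiv :=
  EquivRel homotopicb homotopicb_refl homotopicb_sym homotopicb_trans.

(** The set [[X, Y]] of homotopy classes of maps. *)
Definition htpy_class : Type := {eq_quot homotopicb}.

Definition hclass (f : continuousType X Y) : htpy_class :=
  \pi_({eq_quot homotopicb}) f.

Lemma hclassP (f g : continuousType X Y) :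
  hclass f = hclass g <-> homotopic f g.
Proof.
split=> [/eqquotP/asboolP //|fg].
by apply/eqquotP; apply/asboolP.
Qed.

Definition hrepr (u : htpy_class) : continuousType X Y :=
  repr (u : {eq_quot homotopicb}).

Lemma hreprK u : hclass (hrepr u) = u.
Proof. exact: reprK. Qed.

End equivalence.

Definition htpy_id (X : topologicalType) : htpy_class X X := hclass idfun.

(** Independent of the chosen representatives, see [htpy_compE]. *)
Definition htpy_comp (X Y Z : topologicalType)
    (v : htpy_class Y Z) (u : htpy_class X Y) : htpy_class X Z :=
  hclass (hrepr v \o hrepr u).

Lemma homotopic_comp (X Y Z : topologicalType) (f f' : continuousType X Y)
    (g g' : continuousType Y Z) :
  homotopic f f' -> homotopic g g' -> homotopic (g \o f) (g' \o f').
Proof.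
move=> [F [cF F0 F1]] [G [cG G0 G1]].
exists (fun z => G (F z, z.2)); split.
- move=> z; apply: (@continuous_comp _ _ _ (fun z => (F z, z.2)) G);
    last exact: cG.
  by move: z; apply: pair_continuous => //; exact: snd_continuous.
- by move=> x /=; rewrite F0 G0.
- by move=> x /=; rewrite F1 G1.
Qed.

Lemma htpy_compE (X Y Z : topologicalType) (f : continuousType X Y)
    (g : continuousType Y Z) :
  htpy_comp (hclass g) (hclass f) = hclass (g \o f).
Proof. by apply/hclassP; apply: homotopic_comp; apply/hclassP; exact: hreprK. Qed.

Lemma htpy_comp_idl (X Y : topologicalType) (u : htpy_class X Y) :
  htpy_comp (htpy_id Y) u = u.
Proof.
rewrite -{1}(hreprK u) htpy_compE -[RHS]hreprK.
by congr hclass; apply/continuousEP.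
Qed.

Lemma htpy_comp_idr (X Y : topologicalType) (u : htpy_class X Y) :
  htpy_comp u (htpy_id X) = u.
Proof.
rewrite -{1}(hreprK u) htpy_compE -[RHS]hreprK.
by congr hclass; apply/continuousEP.
Qed.

Lemma htpy_compA (X Y Z W : topologicalType) (w : htpy_class Z W)
    (v : htpy_class Y Z) (u : htpy_class X Y) :
  htpy_comp w (htpy_comp v u) = htpy_comp (htpy_comp w v) u.
Proof.
rewrite -(hreprK w) -(hreprK v) -(hreprK u) !htpy_compE.
by congr hclass; apply/continuousEP.
Qed.

End homotopy.

Record category := Category {
  obj :> Type;
  mor : obj -> obj -> Type;
  idmor : forall A, mor A A;
  mcomp : forall A B C, mor B C -> mor A B -> mor A C;
  mcomp_idl : forall A B (f : mor A B), mcomp (idmor B) f = f;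
  mcomp_idr : forall A B (f : mor A B), mcomp f (idmor A) = f;
  mcompA : forall A B C D (h : mor C D) (g : mor B C) (f : mor A B),
    mcomp h (mcomp g f) = mcomp (mcomp h g) f
}.

Record directed_set := DirectedSet {
  ds_sort :> Type;
  ds_le : ds_sort -> ds_sort -> Prop;
  ds_le_refl : forall a, ds_le a a;
  ds_le_trans : forall a b c, ds_le a b -> ds_le b c -> ds_le a c;
  ds_upper_bound : forall a b, exists2 c, ds_le a c & ds_le b c
}.

Record direct_system (C : category) := DirectSystem {
  sys_index : directed_set;
  sys_term : sys_index -> C;
  sys_bond : forall a b, ds_le a b -> mor (sys_term a) (sys_term b);
  sys_bond_id : forall a (aa : ds_le a a), sys_bond aa = idmor (sys_term a);
  sys_bond_comp : forall a b c (ab : ds_le a b) (bc : ds_le b c) (ac : ds_le a c),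
    mcomp (sys_bond bc) (sys_bond ab) = sys_bond ac
}.

Arguments idmor {c} A.
Arguments sys_term {C} d a.
Arguments sys_bond {C} d {a b} ab.

Section direct_system_morphisms.
Context (C : category).

Record sys_mor (X Y : direct_system C) := SysMor {
  sys_fun : sys_index X -> sys_index Y;
  sys_fun_le : forall a b, ds_le a b -> ds_le (sys_fun a) (sys_fun b);
  component : forall a, mor (sys_term X a) (sys_term Y (sys_fun a));
  component_nat : forall a b (ab : ds_le a b),
    mcomp (sys_bond Y (sys_fun_le ab)) (component a) =
    mcomp (component b) (sys_bond X ab)
}.

Arguments sys_fun {X Y} F a : rename.
Arguments sys_fun_le {X Y} F {a b} ab : rename.
Arguments component {X Y} F a : rename.

Section id_comp.
Context (X Y Z : direct_system C).

Lemma sys_id_nat a b (ab : ds_le a b) :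
  mcomp (sys_bond X ab) (idmor (sys_term X a)) =
  mcomp (idmor (sys_term X b)) (sys_bond X ab).
Proof. by rewrite mcomp_idl mcomp_idr. Qed.

Definition sys_id : sys_mor X X :=
  @SysMor X X id (fun a b ab => ab) (fun a => idmor (sys_term X a)) sys_id_nat.

Context (G : sys_mor Y Z) (F : sys_mor X Y).

Lemma sys_comp_nat a b (ab : ds_le a b) :
  mcomp (sys_bond Z (sys_fun_le G (sys_fun_le F ab)))
       (mcomp (component G (sys_fun F a)) (component F a)) =
  mcomp (mcomp (component G (sys_fun F b)) (component F b)) (sys_bond X ab).
Proof. by rewrite mcompA component_nat -mcompA component_nat mcompA. Qed.

Definition sys_comp : sys_mor X Z :=
  @SysMor X Z (fun a => sys_fun G (sys_fun F a))
    (fun a b ab => sys_fun_le G (sys_fun_le F ab))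
    (fun a => mcomp (component G (sys_fun F a)) (component F a))
    sys_comp_nat.

End id_comp.

Definition sys_equiv (X Y : direct_system C) (F G : sys_mor X Y) : Prop :=
  forall a, exists b (Fab : ds_le (sys_fun F a) b)
                     (Gab : ds_le (sys_fun G a) b),
    mcomp (sys_bond Y Fab) (component F a) =
    mcomp (sys_bond Y Gab) (component G a).

Definition sys_same_type (X Y : direct_system C) : Prop :=
  exists (F : sys_mor X Y) (G : sys_mor Y X),
    sys_equiv (sys_comp G F) (sys_id X) /\ sys_equiv (sys_comp F G) (sys_id Y).

End direct_system_morphisms.

Record compHaus := CompHaus {
  compHaus_sort :> topologicalType;
  compHaus_compact : compact [set: compHaus_sort];
  compHaus_hausdorff : hausdorff_space compHaus_sort
}.

Definition HCpt (R : realType) : category :=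
  @Category compHaus (fun K L => htpy_class R K L)
    (fun K => htpy_id R K) (fun K L M v u => htpy_comp v u)
    (fun K L u => htpy_comp_idl u) (fun K L u => htpy_comp_idr u)
    (fun K L M N w v u => htpy_compA w v u).

Definition homeomorphic (X Y : topologicalType) : Prop :=
  exists (f : X -> Y) (g : Y -> X),
    [/\ continuous f, continuous g, cancel f g & cancel g f].

Definition metrizable (R : realType) (P : topologicalType) : Prop :=
  exists M : metricType R, homeomorphic P M.

(** [set_type] is used rather than total maps [M -> M] so that the empty set
    is a neighborhood retract (of its neighborhood [set0]). *)
Definition neighborhood_retract (M : topologicalType) (A : set M) : Prop :=
  exists U : set M, [/\ open U, A `<=` U &
    exists r : U -> A, continuous r /\ forall x : U, A (\val x) -> \val (r x) = \val x].

Definition is_ANR (R : realType) (P : topologicalType) : Prop :=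
  metrizable R P /\
  forall (M : metricType R) (A : set M),
    closed A -> homeomorphic P A -> neighborhood_retract A.

Record ANR (R : realType) := MkANR {
  ANR_sort :> topologicalType;
  ANR_is_ANR : is_ANR R ANR_sort
}.

Section shape.
Context (R : realType).

(** A natural transformation from [[L, -]] to [[K, -]] over the homotopy
    category of ANRs: a shape map from [K] to [L], note the direction. *)
Record shape_map (K L : compHaus) := ShapeMap {
  shape_app : forall P : ANR R, htpy_class R L P -> htpy_class R K P;
  shape_nat : forall (P Q : ANR R) (v : htpy_class R P Q) (u : htpy_class R L P),
    shape_app (htpy_comp v u) = htpy_comp v (shape_app u)
}.

Lemma shape_mapP (K L : compHaus) (s t : shape_map K L) :
  (forall P u, @shape_app _ _ s P u = @shape_app _ _ t P u) -> s = t.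
Proof.
case: s t => [s sn] [t tn] /= st.
have e : s = t by apply/functional_extensionality_dep => P; apply/funext.
by case: _ / e tn {st} => tn; congr ShapeMap; exact: Prop_irrelevance.
Qed.

Definition shape_id (K : compHaus) : shape_map K K :=
  @ShapeMap K K (fun P u => u) (fun P Q v u => erefl).

Lemma shape_comp_nat (K L M : compHaus) (t : shape_map L M) (s : shape_map K L)
    (P Q : ANR R) (v : htpy_class R P Q) (u : htpy_class R M P) :
  shape_app s (shape_app t (htpy_comp v u)) =
  htpy_comp v (shape_app s (shape_app t u)).
Proof. by rewrite !shape_nat. Qed.

Definition shape_comp (K L M : compHaus) (t : shape_map L M)
    (s : shape_map K L) : shape_map K M :=
  @ShapeMap K M (fun P u => shape_app s (shape_app t u)) (shape_comp_nat t s).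

Lemma shape_comp_idl (K L : compHaus) (s : shape_map K L) :
  shape_comp (shape_id L) s = s.
Proof. exact: shape_mapP. Qed.

Lemma shape_comp_idr (K L : compHaus) (s : shape_map K L) :
  shape_comp s (shape_id K) = s.
Proof. exact: shape_mapP. Qed.

Lemma shape_compA (K L M N : compHaus) (r : shape_map M N)
    (t : shape_map L M) (s : shape_map K L) :
  shape_comp r (shape_comp t s) = shape_comp (shape_comp r t) s.
Proof. exact: shape_mapP. Qed.

Definition ShCpt : category :=
  @Category compHaus shape_map shape_id shape_comp
    shape_comp_idl shape_comp_idr shape_compA.

Lemma induced_shape_nat (K L : compHaus) (phi : htpy_class R K L)
    (P Q : ANR R) (v : htpy_class R P Q) (u : htpy_class R L P) :
  htpy_comp (htpy_comp v u) phi = htpy_comp v (htpy_comp u phi).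
Proof. by rewrite htpy_compA. Qed.

Definition induced_shape (K L : compHaus) (phi : htpy_class R K L) :
    shape_map K L :=
  @ShapeMap K L (fun P u => htpy_comp u phi) (induced_shape_nat phi).

Lemma induced_shape_id (K : compHaus) :
  induced_shape (htpy_id R K) = shape_id K.
Proof. by apply: shape_mapP => P u /=; rewrite htpy_comp_idr. Qed.

Lemma induced_shape_comp (K L M : compHaus) (psi : htpy_class R L M)
    (phi : htpy_class R K L) :
  induced_shape (htpy_comp psi phi) =
  shape_comp (induced_shape psi) (induced_shape phi).
Proof. by apply: shape_mapP => P u /=; rewrite htpy_compA. Qed.

End shape.

Section compact_subsets.
Context (X : topologicalType).

Definition set_incl (K L : set X) (KL : K `<=` L) (x : K) : L :=
  exist _ (\val x) (mem_set (KL _ (set_mem (valP x)))).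

Lemma set_incl_continuous (K L : set X) (KL : K `<=` L) :
  continuous (set_incl KL).
Proof.
apply: continuous_comp_initial => x.
exact: (@initial_continuous K X set_val).
Qed.

Definition incl_map (K L : set X) (KL : K `<=` L) : continuousType K L :=
  mkcts (@set_incl_continuous K L KL).

Definition compact_subset : Type := {K : set X | compact K}.

Lemma compact_subset_ub (K L : compact_subset) :
  exists2 M : compact_subset, sval K `<=` sval M & sval L `<=` sval M.
Proof.
exists (exist _ _ (compactU (svalP K) (svalP L))) => /=.
  exact: subsetUl.
exact: subsetUr.
Qed.

Definition compact_subsets : directed_set :=
  @DirectedSet compact_subset (fun K L => sval K `<=` sval L)
    (fun K => @subset_refl _ (sval K))
    (fun K L M => @subset_trans _ (sval L) (sval K) (sval M))
    compact_subset_ub.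

Lemma set_type_compact (K : set X) : compact K -> compact [set: K].
Proof.
move=> cK F FF _.
have FK : (@set_val X K @ F) K.
  by rewrite /fmap /=; apply: (@filterE _ F) => x; exact: set_valP.
have [p [Kp clp]] := cK _ _ FK.
exists (exist _ p (mem_set Kp)); split => // A B FA [_ [[V oV <-] Vp VB]].
have FA' : (@set_val X K @ F) (set_val @` A).
  by rewrite /fmap /=; apply: filterS FA => x Ax; exists x.
have [_ [[x Ax <-] Vx]] := clp _ _ FA' (open_nbhs_nbhs (conj oV Vp)).
by exists x; split => //; exact: VB.
Qed.

Lemma set_type_hausdorff (K : set X) : hausdorff_space X -> hausdorff_space K.
Proof.
move=> hX x y cxy; apply: val_inj; apply: hX => A B nA nB.
have [z [Az Bz]] := cxy _ _ (@initial_continuous K X set_val x _ nA)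
  (@initial_continuous K X set_val y _ nB).
by exists (\val z).
Qed.

Context (hX : hausdorff_space X).

Definition compact_subspace (K : compact_subset) : compHaus :=
  @CompHaus (sval K : Type) (set_type_compact (svalP K))
    (set_type_hausdorff (K := sval K) hX).

Context (R : realType).

Definition incl_class (K L : compact_subset) (KL : sval K `<=` sval L) :
    htpy_class R (compact_subspace K) (compact_subspace L) :=
  hclass R (incl_map KL).

Lemma incl_class_id (K : compact_subset) (KK : sval K `<=` sval K) :
  incl_class KK = htpy_id R (compact_subspace K).
Proof. by congr hclass; apply/continuousEP => x; exact: val_inj. Qed.

Lemma incl_class_comp (K L M : compact_subset) (KL : sval K `<=` sval L)
    (LM : sval L `<=` sval M) (KM : sval K `<=` sval M) :
  htpy_comp (incl_class LM) (incl_class KL) = incl_class KM.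
Proof.
by rewrite htpy_compE; congr hclass; apply/continuousEP => x; exact: val_inj.
Qed.

Definition CH_system : direct_system (HCpt R) :=
  @DirectSystem (HCpt R) compact_subsets compact_subspace
    incl_class incl_class_id incl_class_comp.

Lemma incl_shape_id (K : compact_subset) (KK : sval K `<=` sval K) :
  induced_shape (incl_class KK) = shape_id R (compact_subspace K).
Proof. by rewrite incl_class_id induced_shape_id. Qed.

Lemma incl_shape_comp (K L M : compact_subset) (KL : sval K `<=` sval L)
    (LM : sval L `<=` sval M) (KM : sval K `<=` sval M) :
  shape_comp (induced_shape (incl_class LM)) (induced_shape (incl_class KL)) =
  induced_shape (incl_class KM).
Proof. by rewrite -induced_shape_comp (incl_class_comp KL LM KM). Qed.

(** The direct system of the same compact subsets in Sh(Cpt). *)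
Definition H_system : direct_system (ShCpt R) :=
  @DirectSystem (ShCpt R) compact_subsets compact_subspace
    (fun K L KL => induced_shape (incl_class KL))
    incl_shape_id incl_shape_comp.

End compact_subsets.

Definition same_CH_shape (R : realType) (X Y : topologicalType)
    (hX : hausdorff_space X) (hY : hausdorff_space Y) : Prop :=
  sys_same_type (CH_system hX R) (CH_system hY R).

Definition same_H_shape (R : realType) (X Y : topologicalType)
    (hX : hausdorff_space X) (hY : hausdorff_space Y) : Prop :=
  sys_same_type (H_system hX R) (H_system hY R).

(* Main.v *)
Require Import Defs.
From mathcomp Require Import all_boot all_classical all_reals topology normedtype.

(** Sending a homotopy class to the shape map it induces by precomposition is
    a functor [HCpt R -> ShCpt R], the identity on objects
    ([shape_functor]). A functor applied to the terms and bonding morphisms of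
    a direct system gives a direct system, and applied to the components of a
    morphism of systems, over the same index function, it gives a morphism of
    systems. The condition for two morphisms of systems to be equivalent is an
    equality of composites at some index; a functor preserves this equality at
    that same index. Hence mutually inverse morphisms up to equivalence stay so
    ([same_type_fmap]). The H-system of a Hausdorff space is exactly the image
    of its CH-system under the shape functor ([H_systemE]). *)

Set Implicit Arguments.
Unset Strict Implicit.
Unset Printing Implicit Defensive.

Record functor (C D : category) := Functor {
  fobj :> C -> D;
  fmor : forall A B : C, mor A B -> mor (fobj A) (fobj B);
  fmor_id : forall A : C, fmor (idmor A) = idmor (fobj A);
  fmor_comp : forall (A B E : C) (g : mor B E) (f : mor A B),
    fmor (mcomp g f) = mcomp (fmor g) (fmor f)
}.

Section functor_on_systems.
Context (C D : category) (T : functor C D).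

Section image_system.
Context (X : direct_system C).

Lemma fmap_bond_id (a : sys_index X) (aa : ds_le a a) :
  fmor T (sys_bond X aa) = idmor (T (sys_term X a)).
Proof. by rewrite sys_bond_id fmor_id. Qed.

Lemma fmap_bond_comp (a b c : sys_index X) (ab : ds_le a b) (bc : ds_le b c)
    (ac : ds_le a c) :
  mcomp (fmor T (sys_bond X bc)) (fmor T (sys_bond X ab)) =
  fmor T (sys_bond X ac).
Proof. by rewrite -fmor_comp (sys_bond_comp ab bc ac). Qed.

Definition fmap_system : direct_system D :=
  @DirectSystem D (sys_index X) (fun a => T (sys_term X a))
    (fun a b ab => fmor T (sys_bond X ab)) fmap_bond_id fmap_bond_comp.

End image_system.

Section image_morphism.
Context (X Y : direct_system C) (F : sys_mor X Y).

Lemma fmap_component_nat (a b : sys_index X) (ab : ds_le a b) :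
  mcomp (sys_bond (fmap_system Y) (sys_fun_le F ab)) (fmor T (component F a)) =
  mcomp (fmor T (component F b)) (sys_bond (fmap_system X) ab).
Proof. by rewrite /= -!fmor_comp component_nat. Qed.

Definition fmap_sys_mor : sys_mor (fmap_system X) (fmap_system Y) :=
  @SysMor D (fmap_system X) (fmap_system Y) (sys_fun F)
    (fun a b ab => sys_fun_le F ab) (fun a => fmor T (component F a))
    fmap_component_nat.

End image_morphism.

Lemma fmap_sys_comp_id (X Y : direct_system C) (F : sys_mor X Y)
    (G : sys_mor Y X) :
  sys_equiv (sys_comp G F) (sys_id X) ->
  sys_equiv (sys_comp (fmap_sys_mor G) (fmap_sys_mor F))
            (sys_id (fmap_system X)).
Proof.
move=> GF a; have [b [GFab [ab e]]] := GF a; exists b, GFab, ab.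
by rewrite /= -!fmor_comp -fmor_id -fmor_comp; congr fmor.
Qed.

Lemma same_type_fmap (X Y : direct_system C) :
  sys_same_type X Y -> sys_same_type (fmap_system X) (fmap_system Y).
Proof.
move=> [F [G [GF FG]]]; exists (fmap_sys_mor F), (fmap_sys_mor G).
by split; exact: fmap_sys_comp_id.
Qed.

End functor_on_systems.

Definition shape_functor (R : realType) : functor (HCpt R) (ShCpt R) :=
  @Functor (HCpt R) (ShCpt R) id (@induced_shape R) (@induced_shape_id R)
    (@induced_shape_comp R).

(** The two systems have the same terms and bonds, and differ only in their
    proofs of the system axioms. *)
Lemma H_systemE (R : realType) (X : topologicalType) (hX : hausdorff_space X) :
  H_system hX R = fmap_system (shape_functor R) (CH_system hX R).
Proof.
by rewrite /H_system /fmap_system /=; congr DirectSystem;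
  exact: Prop_irrelevance.
Qed.

Theorem theorem4p5 (R : realType) (X Y : topologicalType)
    (hX : hausdorff_space X) (hY : hausdorff_space Y) :
  same_CH_shape R hX hY -> same_H_shape R hX hY.
Proof. by rewrite /same_H_shape !H_systemE; exact: same_type_fmap. Qed.
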